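(* The matrix $$A=\begin{pmatrix} \frac15 & \frac15 & \frac35\\[2pt] \frac25 & \frac15 & \frac25\\[2pt] \frac35 & \frac15 & \frac15\end{pmatrix}$$ is row-stochastic but not column-stochastic, and applying column-scaling to it yields the matrix $$C(A)=\begin{pmatrix} \frac16 & \frac13 & \frac12\\[2pt] \frac13 & \frac13 & \frac13\\[2pt] \frac12 & \frac13 & \frac16\end{pmatrix},$$ which is doubly-stochastic. Moreover, multiplying the first row of $A$ by $10$, the second row by $5$ and the third row by $15$ gives the matrix $$M=\begin{pmatrix} 2 & 2 & 6\\ 2 & 1 & 2\\ 9 & 3 & 3\end{pmatrix},$$ which achieves its Sinkhorn limit after only two steps; that is, $M$ is not doubly-stochastic but $C(R(M))$ is doubly-stochastic.
   Context: A square matrix is row-stochastic if each of its rows sums to $1$, column-stochastic if each of its columns sums to $1$, and doubly-stochastic if it is both. For a square matrix $B$ with positive entries, $R(B)$ (row-scaling) is the matrix obtained by dividing each row of $B$ by its sum, and $C(B)$ (column-scaling) is the matrix obtained by dividing each column of $B$ by its sum. The Sinkhorn algorithm alternately applies $R$ and $C$, starting from $B$, and the Sinkhorn limit of $B$ is the limit of the resulting sequence of matrices. *)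

(* Defs.v *)
From HB Require Import structures.
From mathcomp Require Import all_boot all_order all_algebra.
From mathcomp Require Import all_classical all_reals all_analysis.

Set Implicit Arguments.
Unset Strict Implicit.
Unset Printing Implicit Defensive.

Import Order.TTheory GRing.Theory Num.Theory.
Import numFieldNormedType.Exports.

Local Open Scope classical_set_scope.
Local Open Scope ring_scope.

Section Stochastic.
Context {R : realType} {n : nat}.
Implicit Types B L : 'M[R]_n.

Definition row_stochastic B : Prop := forall i, \sum_j B i j = 1.

Definition col_stochastic B : Prop := forall j, \sum_i B i j = 1.

Definition doubly_stochastic B : Prop := row_stochastic B /\ col_stochastic B.

(* The two scalings are total functions; they have their intended meaning
   when the sums divided by are nonzero, e.g. for matrices with positive
   entries. *)
Definition row_scaling B : 'M[R]_n := \matrix_(i, j) (B i j / \sum_k B i k).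

Definition col_scaling B : 'M[R]_n := \matrix_(i, j) (B i j / \sum_k B k j).

(* Row-scaling is the first step: B, R(B), C(R(B)), R(C(R(B))), ... *)
Fixpoint sinkhorn B (k : nat) : 'M[R]_n :=
  if k is k'.+1 then
    if odd k' then col_scaling (sinkhorn B k') else row_scaling (sinkhorn B k')
  else B.

Definition is_sinkhorn_limit B L : Prop := sinkhorn B k @[k --> \oo] --> L.

(* The k-th iterate is the first one equal to the Sinkhorn limit. *)
Definition achieves_sinkhorn_limit_in B (k : nat) : Prop :=
  is_sinkhorn_limit B (sinkhorn B k) /\
  (forall l, (l < k)%N -> sinkhorn B l <> sinkhorn B k).

End Stochastic.

(* Square matrix given by the list of its rows. *)
Definition mx_of_rows {R : realType} (n : nat) (s : seq (seq R)) : 'M[R]_n :=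
  \matrix_(i, j) nth 0 (nth [::] s i) j.

(* The i-th row of B multiplied by the i-th element of c. *)
Definition mul_rows {R : realType} (n : nat) (c : seq R) (B : 'M[R]_n)
    : 'M[R]_n :=
  \matrix_(i, j) (c`_i * B i j).

Definition matA (R : realType) : 'M[R]_3 :=
  mx_of_rows 3 [:: [:: 1 / 5; 1 / 5; 3 / 5];
                   [:: 2 / 5; 1 / 5; 2 / 5];
                   [:: 3 / 5; 1 / 5; 1 / 5]].

Definition matM (R : realType) : 'M[R]_3 :=
  mx_of_rows 3 [:: [:: 2; 2; 6];
                   [:: 2; 1; 2];
                   [:: 9; 3; 3]].

(* Main.v *)
Require Import Defs.
From HB Require Import structures.
From mathcomp Require Import all_boot all_order all_algebra.
From mathcomp Require Import all_classical all_reals all_analysis.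
From mathcomp Require Import ring lra.

Import Order.TTheory GRing.Theory Num.Theory.
Import numFieldNormedType.Exports.

Local Open Scope classical_set_scope.
Local Open Scope ring_scope.

(** Multiplying the rows of a row-stochastic matrix by nonzero constants makes
    those constants the row sums, so row-scaling undoes the multiplication
    ([row_scaling_mul_rows]).  Since the matrix [M] arises from the
    row-stochastic matrix [A] in this way, [R(M) = A], and the Sinkhorn
    iterates of [M] start with [M], [A], [C(A)].

    Doubly-stochastic matrices are fixed by both scalings, so the iteration is
    constant once it reaches one, and the first doubly-stochastic iterate is
    the first to equal the limit ([achieves_first_doubly_stochastic]).  For [M]
    this is [C(A)], because neither [M] nor [A] is doubly-stochastic. *)

Section Scaling.
Context {R : realType} {n : nat}.
Implicit Types B : 'M[R]_n.

Lemma row_scaling_mul_rows (c : seq R) B :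
  (forall i : 'I_n, c`_i != 0) -> row_stochastic B ->
  row_scaling (mul_rows c B) = B.
Proof.
move=> c0 rB; apply/matrixP => i j; rewrite !mxE.
under eq_bigr do rewrite mxE.
by rewrite -mulr_sumr rB mulr1 mulrAC divff ?mul1r.
Qed.

Lemma row_scaling_id B : row_stochastic B -> row_scaling B = B.
Proof. by move=> rB; apply/matrixP => i j; rewrite mxE rB divr1. Qed.

Lemma col_scaling_id B : col_stochastic B -> col_scaling B = B.
Proof. by move=> cB; apply/matrixP => i j; rewrite mxE cB divr1. Qed.

Lemma sinkhorn_stationary B k m :
  doubly_stochastic (sinkhorn B k) -> sinkhorn B (m + k) = sinkhorn B k.
Proof.
move=> [rB cB]; elim: m => // m IHm.
by rewrite addSn /= IHm row_scaling_id // col_scaling_id // if_same.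
Qed.

(** An iterate before the [k]-th differs from it simply because it is not
    doubly-stochastic. *)
Lemma achieves_first_doubly_stochastic B k :
  doubly_stochastic (sinkhorn B k) ->
  (forall l, (l < k)%N -> ~ doubly_stochastic (sinkhorn B l)) ->
  achieves_sinkhorn_limit_in B k.
Proof.
move=> dk ndl; split; last by move=> l /ndl + e; rewrite e.
apply: cvg_near_cst; exists k => // m /= km.
by rewrite -(subnK km) sinkhorn_stationary.
Qed.

End Scaling.

Section Matrices.
Context {R : realType}.

Lemma matA_row_stochastic : row_stochastic (matA R).
Proof.
by case=> [[|[|[|//]]] ?]; rewrite !big_ord_recl big_ord0 !mxE /=; field.
Qed.

Lemma matA_not_col_stochastic : ~ col_stochastic (matA R).
Proof. by move=> /(_ ord0); rewrite !big_ord_recl big_ord0 !mxE /=; lra. Qed.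

Lemma col_scaling_matA :
  col_scaling (matA R) = mx_of_rows 3 [:: [:: 1 / 6; 1 / 3; 1 / 2];
                                          [:: 1 / 3; 1 / 3; 1 / 3];
                                          [:: 1 / 2; 1 / 3; 1 / 6]].
Proof.
apply/matrixP => -[[|[|[|//]]] ?] [[|[|[|//]]] ?];
  by rewrite mxE !big_ord_recl big_ord0 !mxE /=; field.
Qed.

Lemma col_scaling_matA_doubly_stochastic :
  doubly_stochastic (col_scaling (matA R)).
Proof.
rewrite col_scaling_matA.
by split; case=> [[|[|[|//]]] ?]; rewrite !big_ord_recl big_ord0 !mxE /=; field.
Qed.

Lemma mul_rows_matA : mul_rows [:: 10; 5; 15] (matA R) = matM R.
Proof.
by apply/matrixP => -[[|[|[|//]]] ?] [[|[|[|//]]] ?]; rewrite !mxE /=; field.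
Qed.

Lemma row_scaling_matM : row_scaling (matM R) = matA R.
Proof.
rewrite -mul_rows_matA row_scaling_mul_rows //; last exact: matA_row_stochastic.
by case=> [[|[|[|//]]] ?] /=; rewrite pnatr_eq0.
Qed.

Lemma matM_not_doubly_stochastic : ~ doubly_stochastic (matM R).
Proof. by move=> [/(_ ord0)]; rewrite !big_ord_recl big_ord0 !mxE /=; lra. Qed.

End Matrices.

Theorem fact4 (R : realType) :
  (row_stochastic (matA R) /\ ~ col_stochastic (matA R)) /\
  (col_scaling (matA R) =
     mx_of_rows 3 [:: [:: 1 / 6; 1 / 3; 1 / 2];
                      [:: 1 / 3; 1 / 3; 1 / 3];
                      [:: 1 / 2; 1 / 3; 1 / 6]] /\
   doubly_stochastic (col_scaling (matA R))) /\
  mul_rows [:: 10; 5; 15] (matA R) = matM R /\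
  achieves_sinkhorn_limit_in (matM R) 2 /\
  ~ doubly_stochastic (matM R) /\
  doubly_stochastic (col_scaling (row_scaling (matM R))).
Proof.
split; first by split; [exact: matA_row_stochastic
                       | exact: matA_not_col_stochastic].
split; first by split; [exact: col_scaling_matA
                       | exact: col_scaling_matA_doubly_stochastic].
split; first exact: mul_rows_matA.
rewrite row_scaling_matM; split; last first.
  by split; [exact: matM_not_doubly_stochastic
            | exact: col_scaling_matA_doubly_stochastic].
apply: achieves_first_doubly_stochastic => [|[|[|//]] _] /=.
- rewrite row_scaling_matM; exact: col_scaling_matA_doubly_stochastic.
- exact: matM_not_doubly_stochastic.
- by rewrite row_scaling_matM => -[_ /matA_not_col_stochastic].
Qed.
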